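(* $L_{KG}$ can be verified by a 2ADfA with bounded error $\epsilon\in(0,1/2)$. Moreover, the protocol achieves perfect completeness.
   Context: The Knapsack-game language is $L_{KG}=\{ S\, \forall(a_1,b_1)\, \exists(e_1,f_1)\, \cdots \, \forall(a_n,b_n)\, \exists(e_n,f_n) \}$, where $S$ and each $a_i,b_i,e_i,f_i$ are natural numbers given in binary, and for every $x\in \prod_{i=1}^{n}\{a_i,b_i\}$ there exists $y\in \prod_{i=1}^{n}\{e_i,f_i\}$ with $S=\sum_{i=1}^{n}(x_i+y_i)$. An affine state of an $m$-state affine register is a vector $v\in\mathbb{R}^m$ whose entries sum to $1$; affine operators are real matrices whose columns each sum to $1$; weighting observes basis state $e_j$ with probability $|v_j|/\|v\|_1$. A 2ADfA is a two-way deterministic finite automaton on the read-only input $¢ w\$$ (left end-marker ¢, right end-marker \$) equipped with finitely many affine registers (with rational transition matrices), each updated by an affine operator or weighted at each step, with the deterministic state and head move then depending on state, symbol and weighting outcomes; it halts upon entering an accepting or rejecting state. The 2ADfA is the verifier in an Arthur–Merlin proof system (public coins: deterministic states, head moves and weighting outcomes are revealed to the all-powerful prover). Verification with error $\epsilon$ (rational): some prover makes every $w\in L$ accepted with probability at least $1-\epsilon$, and for every $w\notin L$ and every prover, $w$ is rejected with probability at least $1-\epsilon$. Perfect completeness means every $w\in L$ is accepted with probability $1$. *)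

(* Defs.v *)
(* All probabilities are rational (registers have rational
   entries and rational transition matrices), so everything lives in [rat]. *)
From HB Require Import structures.
From mathcomp Require Import all_boot all_order all_algebra.
Set Implicit Arguments. Unset Strict Implicit. Unset Printing Implicit Defensive.
Import Order.TTheory GRing.Theory Num.Theory.
Local Open Scope ring_scope.

Inductive kgsym := K0 | K1 | KForall | KExists | KLPar | KRPar | KComma.

Definition kg2o (x : kgsym) : 'I_7 :=
  match x with
  | K0 => inord 0 | K1 => inord 1 | KForall => inord 2 | KExists => inord 3
  | KLPar => inord 4 | KRPar => inord 5 | KComma => inord 6 end.
Definition o2kg (i : 'I_7) : kgsym :=
  match val i with
  | 0 => K0 | 1 => K1 | 2 => KForall | 3 => KExists | 4 => KLPar | 5 => KRPar
  | _ => KComma end.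
Lemma kg2oK : cancel kg2o o2kg.
Proof. by case; rewrite /o2kg /= inordK. Qed.
HB.instance Definition _ := Finite.copy kgsym (can_type kg2oK).

(* a binary numeral: a nonempty string over {0,1}, most significant bit first *)
Definition bit_sym (b : bool) : kgsym := if b then K1 else K0.
Definition enc_bin (s : seq bool) : seq kgsym := map bit_sym s.
Definition bin_val (s : seq bool) : nat := foldl (fun (acc : nat) (b : bool) => acc.*2 + nat_of_bool b)%N 0%N s.

Definition enc_block (blk : seq bool * seq bool * seq bool * seq bool) : seq kgsym :=
  let: (a, b, e, f) := blk in
  [:: KForall; KLPar] ++ enc_bin a ++ [:: KComma] ++ enc_bin b ++ [:: KRPar] ++
  [:: KExists; KLPar] ++ enc_bin e ++ [:: KComma] ++ enc_bin f ++ [:: KRPar].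

Definition in_LKG (w : seq kgsym) : Prop :=
  exists (s : seq bool) (blks : seq (seq bool * seq bool * seq bool * seq bool)),
    [/\ (0 < size blks)%N,
        s != [::],
        all (fun blk => let: (a, b, e, f) := blk in
                        [&& a != [::], b != [::], e != [::] & f != [::]]) blks,
        w = enc_bin s ++ flatten (map enc_block blks) &
        (* for every x in prod {a_i,b_i} there is y in prod {e_i,f_i} with
           S = sum_i (x_i + y_i) ; x_i = a_i if cx_i else b_i, etc. *)
        forall cx : seq bool, size cx = size blks ->
          exists cy : seq bool, size cy = size blks /\
            bin_val s =
            (\sum_(i < size blks)
               let: (a, b, e, f) := nth ([::], [::], [::], [::]) blks i in
               (bin_val (if nth false cx i then a else b) +
                bin_val (if nth false cy i then e else f)))%N].

Inductive tsym (Sigma : Type) := LEnd | Sym of Sigma | REnd.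
Arguments LEnd {Sigma}. Arguments REnd {Sigma}.

(* head positions: 0 is ¢, 1..|w| the input, |w|+1 is $ *)
Definition tape (Sigma : Type) (w : seq Sigma) (p : nat) : tsym Sigma :=
  if p is p'.+1 then nth REnd (map (@Sym Sigma) w) p' else LEnd.

Inductive hmove := MLeft | MStay | MRight.

(* head update; the head is kept between the end-markers *)
Definition newpos (n p : nat) (m : hmove) : nat :=
  match m with MLeft => p.-1 | MStay => p | MRight => minn p.+1 n.+1 end.

Inductive ract (m : nat) := Op of 'M[rat]_m | Weigh.
Arguments Weigh {m}.

Record ADfA (Sigma : finType) := {
  st : finType;
  gam : finType;                (* communication alphabet of the prover *)
  nreg : nat;
  rdim : 'I_nreg -> nat;        (* register i has (rdim i).+1 basis states *)
  q0 : st;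
  acc_st : pred st;
  rej_st : pred st;
  init : forall i : 'I_nreg, 'cV[rat]_(rdim i).+1;
  act : st -> tsym Sigma -> forall i : 'I_nreg, ract (rdim i).+1;
  (* next state and head move, from state, symbol, weighting outcomes
     (None for registers not weighted) and the prover's message *)
  trans : st -> tsym Sigma ->
          {dffun forall i : 'I_nreg, option 'I_(rdim i).+1} -> gam -> st * hmove
}.

Arguments st {Sigma} a. Arguments gam {Sigma} a. Arguments nreg {Sigma} a.
Arguments rdim {Sigma} a i. Arguments q0 {Sigma} a. Arguments acc_st {Sigma} a.
Arguments rej_st {Sigma} a. Arguments init {Sigma} a i. Arguments act {Sigma} a _ _ i.
Arguments trans {Sigma} a _ _ _ _.

Section Semantics.
Variables (Sigma : finType) (A : ADfA Sigma).

Definition outcome := {dffun forall i : 'I_(nreg A), option 'I_(rdim A i).+1}.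
Definition regs := forall i : 'I_(nreg A), 'cV[rat]_(rdim A i).+1.

Definition affine_vec m (v : 'cV[rat]_m) : Prop := \sum_(j < m) v j 0 = 1.
Definition affine_op m (M : 'M[rat]_m) : Prop :=
  forall j : 'I_m, \sum_(i < m) M i j = 1.

Definition wf_ADfA : Prop :=
  [/\ forall i, affine_vec (init A i),
      forall q a i, (match act A q a i with Op M => affine_op M | Weigh => True end)
    & forall q, ~~ (acc_st A q && rej_st A q)].

Definition l1norm m (v : 'cV[rat]_m) : rat := \sum_(j < m) `|v j 0|.

Definition oprob (q : st A) (a : tsym Sigma) (V : regs) (o : outcome) : rat :=
  \prod_(i < nreg A)
    match act A q a i, o i with
    | Op _, None => 1
    | Weigh, Some j => `|V i j 0| / l1norm (V i)
    | _, _ => 0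
    end.

Definition newregs (q : st A) (a : tsym Sigma) (V : regs) (o : outcome) : regs :=
  fun i => match act A q a i, o i with
           | Op M, _ => M *m V i
           | Weigh, Some j => delta_mx j 0
           | Weigh, None => V i
           end.

(* public history: state, head position and weighting outcomes of each step *)
Definition event := (st A * nat * outcome)%type.
Definition prover := seq event -> gam A.

Fixpoint haltp (b : bool) (w : seq Sigma) (P : prover) (t : nat)
  (q : st A) (p : nat) (V : regs) (h : seq event) {struct t} : rat :=
  if (if b then acc_st A q else rej_st A q) then 1
  else if acc_st A q || rej_st A q then 0
  else match t with
       | 0 => 0
       | t'.+1 =>
         \sum_(o : outcome)
           oprob q (tape w p) V o *
           (let h' := rcons h (q, p, o) in
            let qm := trans A q (tape w p) o (P h') in
            haltp b w P t' qm.1 (newpos (size w) p qm.2)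
                  (newregs q (tape w p) V o) h')
       end.

Definition acc_within w P t := haltp true w P t (q0 A) 0 (init A) [::].
Definition rej_within w P t := haltp false w P t (q0 A) 0 (init A) [::].

(* "the (limit) probability is at least r" *)
Definition prob_ge (f : nat -> rat) (r : rat) : Prop :=
  forall d : rat, 0 < d -> exists t, r - d <= f t.

Definition verifies_with_error (L : seq Sigma -> Prop) (eps : rat) : Prop :=
  wf_ADfA /\
  forall w,
    (L w -> exists P : prover, prob_ge (acc_within w P) (1 - eps)) /\
    (~ L w -> forall P : prover, prob_ge (rej_within w P) (1 - eps)).

Definition perfect_completeness (L : seq Sigma -> Prop) : Prop :=
  forall w, L w -> exists P : prover, prob_ge (acc_within w P) 1.

End Semantics.

(* Main.v *)
(** The verifier first checks the input format deterministically and then plays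
    independent rounds.  In a round it flips one public coin per universal pair,
    walks back, and asks the prover for one bit per existential pair, while an
    affine register accumulates the integer [T = sum x_i + sum y_i - S].  The
    register holds [(p, 1 - p, T, 0, -T)] with [p = eps / 2^(n+1)], so weighting
    it accepts with probability [p / (1 + 2|T|)], starts a new round with
    probability [(1 - p) / (1 + 2|T|)] and rejects with the rest.  If [w] is in
    the language, an honest prover always reaches [T = 0]: no round rejects, and
    some round eventually accepts.  Otherwise a losing [x] is drawn with
    probability at least [2^-n] and is then rejected with probability at least
    [2/3], which outweighs the acceptance probability [p] by a factor of at least [1/eps]. *)
From HB Require Import structures.
Require Import Defs.
From mathcomp Require Import all_boot all_order all_algebra.
From mathcomp Require Import ring lra.
Set Implicit Arguments. Unset Strict Implicit. Unset Printing Implicit Defensive.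
Import Order.TTheory GRing.Theory Num.Theory.
Local Open Scope ring_scope.

(** * The verifier *)

(* [FS st], [FNum q c st]: reading [S], resp. the first ([c = false]) or second
   number of a pair, of which [st] tells whether a digit has been seen;
   [q] distinguishes universal ([false]) from existential pairs.  [FQ q] and
   [FPar q] expect the quantifier [q] and its opening parenthesis. *)
Inductive fstate :=
  | FS of bool
  | FQ of bool
  | FPar of bool
  | FNum of bool & bool & bool.

Definition fstate_enc (f : fstate) : bool + bool + bool + bool * bool * bool :=
  match f with
  | FS b => inl (inl (inl b)) | FQ b => inl (inl (inr b)) | FPar b => inl (inr b)
  | FNum x y z => inr (x, y, z) end.
Definition fstate_dec (x : bool + bool + bool + bool * bool * bool) : fstate :=
  match x with
  | inl (inl (inl b)) => FS b | inl (inl (inr b)) => FQ b | inl (inr b) => FPar b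
  | inr (x, y, z) => FNum x y z end.
Lemma fstate_encK : cancel fstate_enc fstate_dec.
Proof. by case. Qed.
HB.instance Definition _ := Finite.copy fstate (can_type fstate_encK).

Definition fstep (f : fstate) (a : kgsym) : option fstate :=
  match f with
  | FS st => match a with
      | K0 | K1 => Some (FS true)
      | KForall => if st then Some (FPar false) else None
      | _ => None end
  | FQ q => match a with
      | KForall => if q then None else Some (FPar false)
      | KExists => if q then Some (FPar true) else None
      | _ => None end
  | FPar q => if a is KLPar then Some (FNum q false false) else None
  | FNum q c st => match a with
      | K0 | K1 => Some (FNum q c true)
      | KComma => if ~~ c && st then Some (FNum q true false) else None
      | KRPar => if c && st then Some (FQ (~~ q)) else None
      | _ => None end
  end.

(* The mode [m] is [false] in the coin pass and [true] in the pass that queries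
   the prover.  In [Scan m (Some act)] the current number is being added up
   exactly when [act]; the comma of a pair negates [act], so the selection bit of
   a pair is the initial [act].  [S] itself is read in [Scan false (Some true)]. *)
Inductive vstate :=
  | Fmt of fstate
  | Back of bool
  | Scan of bool & option bool
  | Acc
  | Rej.

Definition vstate_enc (q : vstate) : fstate + bool + bool * option bool + bool :=
  match q with
  | Fmt f => inl (inl (inl f)) | Back m => inl (inl (inr m))
  | Scan m s => inl (inr (m, s)) | Acc => inr true | Rej => inr false end.
Definition vstate_dec (x : fstate + bool + bool * option bool + bool) : vstate :=
  match x with
  | inl (inl (inl f)) => Fmt f | inl (inl (inr m)) => Back m
  | inl (inr (m, s)) => Scan m s | inr true => Acc | inr false => Rej end.
Lemma vstate_encK : cancel vstate_enc vstate_dec.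
Proof. by case. Qed.
HB.instance Definition _ := Finite.copy vstate (can_type vstate_encK).

(** * Affine vectors and operators of the two registers *)

Definition colvec (s : seq rat) : 'cV[rat]_5 := \col_i s`_i.
Definition rowsmx (rows : seq (seq rat)) : 'M[rat]_5 :=
  \matrix_(i, j) (nth [::] rows i)`_j.

Definition coin : 'cV[rat]_5 := colvec [:: 1/2; 1/2; 0; 0; 0].
(* [T] is the running balance, [c] the value of the numeral being read; the
   second and last entries pad the sum to 1. *)
Definition vec (p T c : rat) : 'cV[rat]_5 := colvec [:: p; 1 - p; T; c; - T - c].

Definition constmx (v : 'cV[rat]_5) : 'M[rat]_5 := \matrix_(i, j) v i 0.
(** One Horner step: the constant [d] enters through the first two entries, which sum to 1 in [vec],
    and the last row restores the column sums. *)
Definition digmx (d : rat) := rowsmx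
  [:: [:: 1; 0; 0; 0; 0]; [:: 0; 1; 0; 0; 0]; [:: 0; 0; 1; 0; 0];
      [:: d; d; 0; 2; 0]; [:: - d; - d; 0; -1; 1]].
Definition flushmx := rowsmx
  [:: [:: 1; 0; 0; 0; 0]; [:: 0; 1; 0; 0; 0]; [:: 0; 0; 1; 1; 0];
      [:: 0; 0; 0; 0; 0]; [:: 0; 0; 0; 0; 1]].
(** Applied at each universal quantifier and at the right end-marker of the coin pass, hence [n + 1]
    times for [n] blocks. The first time, [c] is the value of [S]; later [c] is 0 and only the
    halving of [p] takes effect. *)
Definition debitmx := rowsmx
  [:: [:: 1/2; 0; 0; 0; 0]; [:: 1/2; 1; 0; 0; 0]; [:: 0; 0; 1; -1; 0];
      [:: 0; 0; 0; 0; 0]; [:: 0; 0; 0; 2; 1]].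

Lemma sum5 (F : 'I_5 -> rat) : \sum_i F i =
  F (inord 0) + F (inord 1) + F (inord 2) + F (inord 3) + F (inord 4).
Proof.
rewrite !big_ord_recl big_ord0 addr0 !addrA.
by congr (F _ + F _ + F _ + F _ + F _); apply/val_inj; rewrite /= inordK.
Qed.

Lemma ord5P (P : 'I_5 -> Prop) :
  P (inord 0) -> P (inord 1) -> P (inord 2) -> P (inord 3) -> P (inord 4) ->
  forall j, P j.
Proof.
move=> p0 p1 p2 p3 p4 j; rewrite -(inord_val j).
by case: j; do 5?case=> //.
Qed.

Lemma affine_colvec a b c d e :
  a + b + c + d + e = 1 -> affine_vec (colvec [:: a; b; c; d; e]).
Proof. by move=> H; rewrite /affine_vec sum5 !mxE !inordK. Qed.

Lemma affine_coin : affine_vec coin.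
Proof. by apply: affine_colvec; field. Qed.
Lemma affine_vec_vec p T c : affine_vec (vec p T c).
Proof. by apply: affine_colvec; ring. Qed.

Lemma affine_constmx v : affine_vec v -> affine_op (constmx v).
Proof. by move=> H j; rewrite -[RHS]H; apply: eq_bigr => i _; rewrite !mxE. Qed.
(** All columns equal [v], so the product is [v] times the entry sum of [u]. This resets a register
    without weighting it. *)
Lemma constmxE v u : affine_vec u -> constmx v *m u = v.
Proof.
move=> H; apply/matrixP => i j; rewrite !mxE (eq_bigr (fun k => v i 0 * u k 0)).
  by rewrite -mulr_sumr H mulr1 (ord1 j).
by move=> k _; rewrite mxE (ord1 j).
Qed.

Lemma affine_digmx d : affine_op (digmx d).
Proof. by apply: ord5P; rewrite sum5 !mxE !inordK //=; ring. Qed.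
Lemma affine_flushmx : affine_op flushmx.
Proof. by apply: ord5P; rewrite sum5 !mxE !inordK //=; ring. Qed.
Lemma affine_debitmx : affine_op debitmx.
Proof. by apply: ord5P; rewrite sum5 !mxE !inordK //=; field. Qed.
Lemma affine_1mx : affine_op (1%:M : 'M[rat]_5).
Proof.
move=> j; rewrite (bigD1 j) //= big1 ?mxE ?eqxx ?addr0 // => i ne.
by rewrite mxE (negPf ne).
Qed.

Lemma digmxE d p T c : digmx d *m vec p T c = vec p T (c *+ 2 + d).
Proof.
apply/matrixP => i j; move: i; rewrite (ord1 j) => {j}.
by apply: ord5P; rewrite !mxE sum5 !mxE !inordK //=; ring.
Qed.
Lemma flushmxE p T c : flushmx *m vec p T c = vec p (T + c) 0.
Proof.
apply/matrixP => i j; move: i; rewrite (ord1 j) => {j}.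
by apply: ord5P; rewrite !mxE sum5 !mxE !inordK //=; ring.
Qed.
Lemma debitmxE p T c : debitmx *m vec p T c = vec (p / 2) (T - c) 0.
Proof.
apply/matrixP => i j; move: i; rewrite (ord1 j) => {j}.
by apply: ord5P; rewrite !mxE sum5 !mxE !inordK //=; field.
Qed.

(** * Transition tables of the verifier *)

Definition coinstep (q : vstate) (a : tsym kgsym) : bool :=
  match q, a with Scan false _, Sym KForall => true | _, _ => false end.
Definition checkstep (q : vstate) (a : tsym kgsym) : bool :=
  match q, a with Scan true _, REnd => true | _, _ => false end.

Definition accop (delta : rat) (q : vstate) (a : tsym kgsym) : 'M[rat]_5 :=
  match q, a with
  | Scan _ (Some true), Sym K0 => digmx 0
  | Scan _ (Some true), Sym K1 => digmx 1
  | Scan _ (Some _), Sym (KComma | KRPar) => flushmx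
  | Scan false _, (Sym KForall | REnd) => debitmx
  | Back false, LEnd => constmx (vec delta 0 0)
  | _, _ => 1%:M
  end.

Lemma affine_accop delta q a : affine_op (accop delta q a).
Proof.
case: q => [f|[]|[] [[]|]||]; case: a => [|[]|]; rewrite /accop;
by [exact: affine_1mx|exact: affine_digmx|exact: affine_flushmx|exact: affine_debitmx
   |apply: affine_constmx; exact: affine_vec_vec].
Qed.

Definition vtrans (q : vstate) (a : tsym kgsym) (o0 o1 : option 'I_5) (g : bool) :
    vstate * hmove :=
  match q, a with
  | Fmt f, LEnd => (Fmt f, MRight)
  | Fmt f, Sym x => if fstep f x is Some f' then (Fmt f', MRight) else (Rej, MStay)
  | Fmt f, REnd => if f is FQ false then (Back false, MLeft) else (Rej, MStay)
  | Back m, LEnd => (Scan m (if m then None else Some true), MRight)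
  | Back m, _ => (Back m, MLeft)
  | Scan m s, Sym x =>
      (Scan m match x with
              | KForall => if m then s else Some (o0 == Some ord0)
              | KExists => if m then Some g else s
              | KComma => omap negb s
              | KRPar => None
              | _ => s end, MRight)
  | Scan m _, REnd =>
      if m then match omap val o1 with
                | Some 0 => (Acc, MStay) | Some 1 => (Back false, MLeft)
                | _ => (Rej, MStay) end
      else (Back true, MLeft)
  | _, _ => (q, MStay)
  end.

Arguments vtrans : simpl never.

(** Register 0 is the coin, reset at every step that does not weigh it; register 1 is the
    accumulator. *)
Definition kg_verifier (delta : rat) : ADfA kgsym := {|
  st := vstate; gam := bool; nreg := 2; rdim := fun _ => 4;
  q0 := Fmt (FS false);
  acc_st := fun q => if q is Acc then true else false;
  rej_st := fun q => if q is Rej then true else false;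
  init := fun i => if val i is 0 then coin else vec delta 0 0;
  act := fun q a i =>
    if val i is 0 then (if coinstep q a then Weigh else Op (constmx coin))
    else (if checkstep q a then Weigh else Op (accop delta q a));
  trans := fun q a o g => vtrans q a (o ord0) (o (lift ord0 ord0)) g
|}.

Lemma kg_verifier_wf delta : wf_ADfA (kg_verifier delta).
Proof.
split.
- by case=> [[|i] lti] /=; [exact: affine_coin|exact: affine_vec_vec].
- move=> q a [[|i] lti] /=; case: ifP => // _; last exact: affine_accop.
  by apply: affine_constmx; exact: affine_coin.
- by case.
Qed.

(** * Lower bounds on halting probabilities *)

Section Run.
Variables (delta : rat) (b : bool) (w : seq kgsym) (P : prover (kg_verifier delta)).
Local Notation A := (kg_verifier delta).
Implicit Types (q : vstate) (V : regs A) (h : seq (event A)) (o : outcome A).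

Local Notation i0 := (ord0 : 'I_(nreg A)).
Local Notation i1 := (lift ord0 ord0 : 'I_(nreg A)).

Definition mko (a c : option 'I_5) : outcome A :=
  [ffun i : 'I_2 => if val i is 0 then a else c].

Lemma mko0 a c : mko a c i0 = a. Proof. by rewrite ffunE. Qed.
Lemma mko1 a c : mko a c i1 = c. Proof. by rewrite ffunE. Qed.

Lemma mkoK o : mko (o i0) (o i1) = o.
Proof.
apply/ffunP => i; rewrite ffunE; case: i => [[|[|i]] lti] //=.
  by have -> : Ordinal lti = ord0 by apply/val_inj.
by have -> : Ordinal lti = lift ord0 ord0 by apply/val_inj.
Qed.

Lemma sum_outcome (F : outcome A -> rat) :
  \sum_o F o = \sum_a \sum_c F (mko a c).
Proof.
rewrite pair_big /= (reindex (fun x => mko x.1 x.2)) //=.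
exists (fun o : outcome A => (o i0, o i1)) => [[a c] _|o _] /=.
  by rewrite mko0 mko1.
exact: mkoK.
Qed.

Definition rprob m (r : ract m) (v : 'cV[rat]_m) (o : option 'I_m) : rat :=
  match r, o with
  | Op _, None => 1 | Weigh, Some j => `|v j 0| / l1norm v | _, _ => 0 end.

Lemma oprobE q a V o : @oprob _ A q a V o =
  rprob (act A q a i0) (V i0) (o i0) * rprob (act A q a i1) (V i1) (o i1).
Proof. by rewrite /oprob !big_ord_recl big_ord0 mulr1. Qed.

Local Notation H := (haltp b w P).
Definition nonhalting q := match q with Acc | Rej => false | _ => true end.

Definition after t q p V h o :=
  let h' := rcons h (q, p, o) in
  let qm := trans A q (tape w p) o (P h') in
  H t qm.1 (newpos (size w) p qm.2) (@newregs _ A q (tape w p) V o) h'.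

Lemma haltpS t q p V h : nonhalting q ->
  H t.+1 q p V h = \sum_o @oprob _ A q (tape w p) V o * after t q p V h o.
Proof.
move=> nh; have [E1 E2] : (if b then acc_st A q else rej_st A q) = false /\
    acc_st A q || rej_st A q = false by case: q nh => //=; rewrite if_same.
by rewrite [LHS]/= E1 E2.
Qed.

Lemma sum_option (I : finType) (F : option I -> rat) :
  \sum_a F a = F None + \sum_i F (Some i).
Proof.
rewrite (bigD1 None) //= (reindex_omap Some id) => [|[i|]//].
by congr (_ + _); apply: eq_bigl => i; rewrite eqxx.
Qed.

Lemma l1norm_ge0 m (v : 'cV[rat]_m) : 0 <= l1norm v.
Proof. exact: sumr_ge0. Qed.

Lemma rprob_ge0 m (r : ract m) v (o : option 'I_m) : 0 <= rprob r v o.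
Proof. by case: r o => [M|] [j|] //=; rewrite divr_ge0 ?l1norm_ge0. Qed.

Lemma oprob_ge0 q a V o : 0 <= @oprob _ A q a V o.
Proof. by rewrite oprobE mulr_ge0 ?rprob_ge0. Qed.

Lemma haltp_Acc t p V h : H t Acc p V h = b%:R.
Proof. by case: t => /=; case: b. Qed.
Lemma haltp_Rej t p V h : H t Rej p V h = (~~ b)%:R.
Proof. by case: t => /=; case: b. Qed.
Lemma haltp0 q p V h : nonhalting q -> H 0 q p V h = 0.
Proof. by case: q => //= *; rewrite if_same. Qed.

Lemma haltp_ge0 t q p V h : 0 <= H t q p V h.
Proof.
elim: t q p V h => [|t IH] q p V h; case nh: (nonhalting q);
  try by case: q nh => //; rewrite ?haltp_Acc ?haltp_Rej ler0n.
  by rewrite haltp0.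
rewrite haltpS //; apply: sumr_ge0 => o _.
by rewrite mulr_ge0 ?oprob_ge0 ?IH.
Qed.

Lemma haltp_leS t q p V h : H t q p V h <= H t.+1 q p V h.
Proof.
elim: t q p V h => [|t IH] q p V h; case nh: (nonhalting q);
  try by case: q nh => //; rewrite ?haltp_Acc ?haltp_Rej.
  by rewrite haltp0 // haltp_ge0.
rewrite !haltpS //; apply: ler_sum => o _.
by apply: ler_wpM2l; [exact: oprob_ge0|exact: IH].
Qed.

(** Monotonicity in time lets branches with different time bounds share their maximum. *)
Lemma haltp_le t t' q p V h : (t <= t')%N -> H t q p V h <= H t' q p V h.
Proof.
move/subnK <-; elim: (t' - t)%N => [//|n IH].
exact: le_trans IH (haltp_leS _ _ _ _ _).
Qed.

Lemma after_ge0 t q p V h o : 0 <= after t q p V h o.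
Proof. exact: haltp_ge0. Qed.

(** When neither register is weighted, [None] for both is the only outcome of nonzero
    probability. *)
Lemma step_det t q p V h : nonhalting q ->
  ~~ coinstep q (tape w p) -> ~~ checkstep q (tape w p) ->
  H t.+1 q p V h = after t q p V h (mko None None).
Proof.
move=> nh nc nk; rewrite haltpS // sum_outcome (bigD1 None) //=.
rewrite [X in _ + X]big1 => [|[j|] // _]; last first.
  by apply: big1 => c _; rewrite oprobE mko0 /= (negPf nc) mul0r mul0r.
rewrite addr0 (bigD1 None) //= big1 => [|[j|] // _]; last first.
  by rewrite oprobE mko1 /= (negPf nk) mulr0 mul0r.
by rewrite oprobE mko0 mko1 /= (negPf nc) (negPf nk) !mul1r addr0.
Qed.

Definition coinbits h : seq bool :=
  pmap (fun e : event A => omap (fun j => j == ord0) (e.2 i0)) h.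

Lemma coinbits_rcons h q p (o0 o1 : option 'I_5) :
  coinbits (rcons h (q, p, mko o0 o1)) =
  coinbits h ++ (if o0 is Some j then [:: j == ord0] else [::]).
Proof. by rewrite /coinbits -cats1 pmap_cat /= mko0; case: o0. Qed.

(** A weighted coin register is some basis vector, of which only affinity is recorded; that is what
    [constmxE] asks for at the next reset. *)
Definition regok (rdy : bool) (pr T c : rat) V :=
  [/\ affine_vec (V i0), rdy -> V i0 = coin & V i1 = vec pr T c].

Definition endbits (hb : seq bool) h := exists bs, coinbits h = bs ++ hb.

(* Some time bound makes the halting probability at least [x], uniformly in the
   register contents described by [rdy, pr, T, c] and in the past of which only
   the last coin flips [hb] are prescribed.  [rdy] says that the coin register has
   been reset. *)
Definition value_ge (x : rat) q p rdy pr T c hb := exists t, forall V h,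
  regok rdy pr T c V -> endbits hb h -> x <= H t q p V h.

(** * Rules for single steps *)

Lemma ev_weak x y q p rdy pr T c hb :
  y <= x -> value_ge x q p rdy pr T c hb -> value_ge y q p rdy pr T c hb.
Proof.
by move=> le [t Ht]; exists t => V h Vok hok; apply: le_trans le (Ht _ _ _ _).
Qed.

Lemma ev_nil x q p rdy pr T c hb :
  value_ge x q p rdy pr T c [::] -> value_ge x q p rdy pr T c hb.
Proof.
move=> [t Ht]; exists t => V h Vok _; apply: Ht => //.
by exists (coinbits h); rewrite cats0.
Qed.

Lemma ev0 q p rdy pr T c hb : value_ge 0 q p rdy pr T c hb.
Proof. by exists 0%N => V h _ _; exact: haltp_ge0. Qed.

(** The message depends on the history, whereas the time bound must not, so the bounds for the two
    possible messages are merged. [ok] holds what is known about the prover. *)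
Lemma ev_msg (ok : pred bool) x q p rdy pr T c hb pr' T' c' :
  nonhalting q -> ~~ coinstep q (tape w p) -> ~~ checkstep q (tape w p) ->
  accop delta q (tape w p) *m vec pr T c = vec pr' T' c' ->
  (forall h, endbits hb h -> ok (P (rcons h (q, p, mko None None)))) ->
  (forall g, ok g -> let qm := vtrans q (tape w p) None None g in
     value_ge x qm.1 (newpos (size w) p qm.2) true pr' T' c' hb) ->
  value_ge x q p rdy pr T c hb.
Proof.
move=> nh nc nk HV okP Hg.
have [t Ht] : exists t, forall g, ok g -> forall V h,
    regok true pr' T' c' V -> endbits hb h ->
    let qm := vtrans q (tape w p) None None g in
    x <= H t qm.1 (newpos (size w) p qm.2) V h.
  have Hg' g : exists t, ok g -> forall V h,
      regok true pr' T' c' V -> endbits hb h ->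
      let qm := vtrans q (tape w p) None None g in
      x <= H t qm.1 (newpos (size w) p qm.2) V h.
    case E: (ok g); last by exists 0%N.
    by have [t Ht] := Hg g E; exists t.
  have [[t1 H1] [t2 H2]] := (Hg' true, Hg' false).
  exists (maxn t1 t2) => -[] gok V h Vok hok.
    by apply: le_trans (H1 gok V h Vok hok) _; apply: haltp_le; rewrite leq_maxl.
  by apply: le_trans (H2 gok V h Vok hok) _; apply: haltp_le; rewrite leq_maxr.
exists t.+1 => V h [V0 _ V1] hok; rewrite step_det // /after /= mko0 mko1.
apply: Ht; first exact: okP.
  have E0 : @newregs _ A q (tape w p) V (mko None None) i0 = coin.
    by rewrite /newregs /= (negPf nc) constmxE.
  split; rewrite ?E0 //; first exact: affine_coin.
  by rewrite /newregs /= (negPf nk) V1.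
by case: hok => bs E; exists bs; rewrite coinbits_rcons cats0.
Qed.

Lemma ev_det x q p rdy pr T c hb pr' T' c' :
  nonhalting q -> ~~ coinstep q (tape w p) -> ~~ checkstep q (tape w p) ->
  accop delta q (tape w p) *m vec pr T c = vec pr' T' c' ->
  (forall g, let qm := vtrans q (tape w p) None None g in
     value_ge x qm.1 (newpos (size w) p qm.2) true pr' T' c' hb) ->
  value_ge x q p rdy pr T c hb.
Proof. by move=> nh nc nk HV Hg; apply: (ev_msg (ok := predT)) HV _ _. Qed.

Lemma affine_delta (j : 'I_5) : affine_vec (delta_mx j 0 : 'cV[rat]_5).
Proof.
rewrite /affine_vec (bigD1 j) //= big1 ?mxE ?eqxx ?addr0 // => i ne.
by rewrite mxE (negPf ne).
Qed.

Lemma l1norm_coin : l1norm coin = 1.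
Proof. by rewrite /l1norm sum5 !mxE !inordK //= !normr0; lra. Qed.

(** Outcomes 0 and 1 have probability 1/2 each. The coin is spent afterwards, hence [rdy] turns from
    true to false. *)
Lemma ev_coin x y s p pr T c hb : tape w p = Sym KForall ->
  value_ge x (Scan false (Some true)) (newpos (size w) p MRight) false
     (pr / 2) (T - c) 0 (rcons hb true) ->
  value_ge y (Scan false (Some false)) (newpos (size w) p MRight) false
     (pr / 2) (T - c) 0 (rcons hb false) ->
  value_ge ((x + y) / 2) (Scan false s) p true pr T c hb.
Proof.
move=> tp [t1 H1] [t2 H2]; exists (maxn t1 t2).+1 => V h [_ /(_ isT) V0 V1] hok.
rewrite haltpS // sum_outcome sum_option.
pose z (j : 'I_5) := if j == ord0 then x else y.
have Hz (j : 'I_5) V' h' : regok false (pr / 2) (T - c) 0 V' ->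
    endbits (rcons hb (j == ord0)) h' ->
    z j <= H (maxn t1 t2) (Scan false (Some (j == ord0)))
             (newpos (size w) p MRight) V' h'.
  rewrite /z; case: eqP => _ Vok hok'.
    by apply: le_trans (H1 _ _ Vok hok') _; rewrite haltp_le ?leq_maxl.
  by apply: le_trans (H2 _ _ Vok hok') _; rewrite haltp_le ?leq_maxr.
have coin_ge0 j : 0 <= coin j 0 by move: j; apply: ord5P; rewrite mxE inordK //=.
(* As [coin j 0] vanishes for [j > 1], this sum is the average of [x] and [y]. *)
apply: (@le_trans _ _ (\sum_j z j * coin j 0)).
  rewrite sum5 /z !mxE !inordK //= !mulr0 !addr0 -[ord0](inord_val ord0) eqxx.
  by rewrite -val_eqE /= !inordK //=; lra.
(* Only outcomes with a weighted coin and an unweighted accumulator are kept; the other terms are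
   nonnegative. *)
rewrite -[leLHS]add0r lerD //.
  by apply: sumr_ge0 => a _; rewrite mulr_ge0 ?oprob_ge0 ?after_ge0.
apply: ler_sum => j _; rewrite sum_option.
rewrite -[leLHS]addr0 lerD //; last first.
  by apply: sumr_ge0 => a _; rewrite mulr_ge0 ?oprob_ge0 ?after_ge0.
rewrite oprobE mko0 mko1 tp /= mulr1 V0 l1norm_coin divr1 ger0_norm //.
rewrite mulrC ler_wpM2l // /after tp /= ?mko0 ?mko1 /vtrans /=.
apply: Hz.
  split=> //; first by rewrite /newregs /= mko0; exact: affine_delta.
  rewrite /newregs /= V1; case: s => [[]|]; exact: debitmxE.
case: hok => bs E; exists bs.
by rewrite coinbits_rcons E -cats1 catA.
Qed.

Lemma l1norm_vec (pr T : rat) : 0 <= pr -> pr <= 1 -> l1norm (vec pr T 0) = 1 + 2 * `|T|.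
Proof.
move=> p0 p1; rewrite /l1norm sum5 !mxE !inordK //= normr0 (subr0 (- T)) normrN.
by rewrite (ger0_norm p0) (@ger0_norm _ (1 - pr)) ?subr_ge0 //; lra.
Qed.

(** Outcome 0 accepts, outcome 1 opens a new round worth [x], and outcomes 2 and 4 reject with joint
    weight [2|T|]; outcome 3 has weight 0. After outcome 1 the accumulator is the second basis
    vector, which is [vec 0 0 0]. *)
Lemma ev_check x s p rdy pr T hb : tape w p = REnd -> 0 <= pr -> pr <= 1 ->
  value_ge x (Back false) p.-1 true 0 0 0 [::] ->
  value_ge (((if b then pr else 2 * `|T|) + (1 - pr) * x) / (1 + 2 * `|T|))
     (Scan true s) p rdy pr T 0 hb.
Proof.
move=> tp p0 p1 [t Ht]; exists t.+1 => V h [V0 _ V1] hok.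
rewrite haltpS // sum_outcome sum_option -[leLHS]addr0 lerD //; last first.
  by apply: sumr_ge0 => a _; apply: sumr_ge0 => c _;
     rewrite mulr_ge0 ?oprob_ge0 ?after_ge0.
rewrite sum_option -[leLHS]add0r lerD ?mulr_ge0 ?oprob_ge0 ?after_ge0 //.
pose z (j : 'I_5) : rat :=
  match val j with 0 => b%:R | 1 => x | _ => (~~ b)%:R end.
apply: (@le_trans _ _ (\sum_j `|vec pr T 0 j 0| * z j / (1 + 2 * `|T|))).
  rewrite sum5 /z !mxE !inordK //= (subr0 (- T)) normrN (ger0_norm p0).
  rewrite (@ger0_norm _ (1 - pr)) ?subr_ge0 //.
  rewrite -!mulrDl ler_wpM2r ?invr_ge0 ?addr_ge0 ?mulr_ge0 //.
  by rewrite !inordK //= normr0; case: (b) => /=; lra.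
apply: ler_sum => j _; rewrite oprobE mko0 mko1 tp /= mul1r V1 l1norm_vec //.
rewrite mulrAC ler_wpM2l // ?divr_ge0 ?addr_ge0 ?mulr_ge0 //.
rewrite /after tp /= mko0 mko1 /vtrans /z.
case: j => [[|[|j]] ltj] /=; rewrite ?haltp_Acc ?haltp_Rej //.
apply: Ht.
  have E0 : @newregs _ A (Scan true s) REnd V (mko None (Some (Ordinal ltj))) i0 = coin.
    by rewrite /newregs /= constmxE.
  split; rewrite ?E0 //; first exact: affine_coin.
  rewrite /newregs /= mko1; apply/matrixP => i k; rewrite (ord1 k).
  by move: i; apply: ord5P; rewrite !mxE -val_eqE /= !inordK //= ?subr0 ?oppr0.
by eexists; rewrite cats0.
Qed.
End Run.

Arguments ev_msg {delta b w P ok x q p rdy pr T c hb pr' T' c'}.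
Arguments ev_det {delta b w P x q p rdy pr T c hb pr' T' c'}.

(** * The scanning passes *)

Lemma tape_sym (pre rest : seq kgsym) a :
  tape (pre ++ a :: rest) (size pre).+1 = Sym a.
Proof. by rewrite /= map_cat nth_cat size_map ltnn subnn. Qed.

Lemma tape_end (w : seq kgsym) : tape w (size w).+1 = REnd.
Proof. by rewrite /= nth_default // size_map. Qed.

Lemma newpos_right (pre rest : seq kgsym) a :
  newpos (size (pre ++ a :: rest)) (size pre).+1 MRight = (size (rcons pre a)).+1.
Proof.
rewrite /= size_cat /= size_rcons addnS; apply/minn_idPl.
by rewrite !ltnS leq_addr.
Qed.

Definition blk_univ (x : seq bool * seq bool * seq bool * seq bool) : seq bool * seq bool :=
  let: (a, b, e, f) := x in (a, b).
Definition blk_exis (x : seq bool * seq bool * seq bool * seq bool) : seq bool * seq bool :=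
  let: (a, b, e, f) := x in (e, f).
Definition enc_pair (x : seq bool * seq bool) : seq kgsym :=
  KLPar :: enc_bin x.1 ++ KComma :: enc_bin x.2 ++ [:: KRPar].
Definition selsum (ps : seq (seq bool * seq bool)) (cs : seq bool) : nat :=
  sumn [seq bin_val (if x.2 then x.1.1 else x.1.2) | x <- zip ps cs].

Arguments enc_pair : simpl never.

Lemma enc_blockE blk :
  enc_block blk = KForall :: enc_pair (blk_univ blk) ++ KExists :: enc_pair (blk_exis blk).
Proof.
by case: blk => [[[a b] e] f]; rewrite /enc_block /enc_pair /= -!catA /= -!catA.
Qed.

(** The quantifier that opens a selection in mode [m]; in [Scan m None] every other symbol is passed
    over without effect. *)
Definition trigger (m : bool) (a : kgsym) : bool :=
  match a with KExists => m | KForall => ~~ m | _ => false end.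

Lemma no_trigger_pair m x : all (predC (trigger m)) (enc_pair x).
Proof.
have nb s : all (predC (trigger m)) (enc_bin s).
  by elim: s => //= -[] s ->.
by rewrite /enc_pair /= all_cat /= all_cat /= !nb.
Qed.

Section Passes.
Variables (delta : rat) (b : bool) (w : seq kgsym) (P : prover (kg_verifier delta)).
Local Notation value_ge := (value_ge b w P).

(* [value_ge] with the head position given by the unread suffix of the input. *)
Definition value_ge_at (x : rat) q rest rdy pr T c hb := forall pre, w = pre ++ rest ->
  value_ge x q (size pre).+1 rdy pr T c hb.

Lemma es_step x q a rest q' rdy pr T c pr' T' c' hb :
  nonhalting q -> ~~ coinstep q (Sym a) ->
  accop delta q (Sym a) *m vec pr T c = vec pr' T' c' ->
  (forall g, vtrans q (Sym a) None None g = (q', MRight)) ->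
  value_ge_at x q' rest true pr' T' c' hb -> value_ge_at x q (a :: rest) rdy pr T c hb.
Proof.
move=> nh nc HV Ht Hr pre Ew; have tp := tape_sym pre rest a.
rewrite -Ew in tp; apply: ev_det; rewrite ?tp //; first by case: q {nh nc HV Ht} => //= -[].
- exact: HV.
- move=> g; rewrite Ht /=.
  have -> : minn (size pre).+2 (size w).+1 = (size (rcons pre a)).+1.
    by rewrite -(newpos_right pre rest a) -Ew.
  by apply: Hr; rewrite cat_rcons.
Qed.

Arguments es_step {x q a rest q' rdy pr T c pr' T' c' hb}.

(** Stated for any initial [c], since [bin_val] is a left fold with an accumulator. *)
Lemma es_num_on x m s rest pr T (c : nat) hb :
  value_ge_at x (Scan m (Some true)) rest true pr T
     (foldl (fun (acc : nat) (b : bool) => acc.*2 + b)%N c s)%:R hb ->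
  value_ge_at x (Scan m (Some true)) (enc_bin s ++ rest) true pr T c%:R hb.
Proof.
elim: s c => [|d s IH] c //= Hr.
apply: (es_step (q' := Scan m (Some true)) (pr' := pr) (T' := T)
                (c' := (c.*2 + d)%N%:R)) => //.
- by case: (d); case: (m).
- have E : (c.*2 + d)%N%:R = c%:R *+ 2 + d%:R :> rat.
    by rewrite natrD -muln2 natrM mulr_natr.
  by rewrite E; case: (d); case: (m); exact: digmxE.
- by case: (d); case: (m).
- exact: IH.
Qed.

Lemma es_skip_sym x m s a rest pr T c hb : s != Some true ->
  (match a with K0 | K1 | KLPar => true | _ => false end) ->
  value_ge_at x (Scan m s) rest true pr T c hb ->
  forall rdy, value_ge_at x (Scan m s) (a :: rest) rdy pr T c hb.
Proof.
move=> sn ain Hr rdy; apply: (es_step _ _ _ _ Hr) => //.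
- by case: (m) ain => //; case: (a).
- suff -> : accop delta (Scan m s) (Sym a) = 1%:M by rewrite mul1mx.
  by case: (s) sn ain => [[]|]; case: (m); case: (a).
- by case: (a) ain; case: (m).
Qed.

Lemma es_num_off x m s0 s rest pr T c hb : s0 != Some true ->
  value_ge_at x (Scan m s0) rest true pr T c hb ->
  value_ge_at x (Scan m s0) (enc_bin s ++ rest) true pr T c hb.
Proof.
move=> ns Hr; elim: s => [//|d s IH] /=.
by apply: es_skip_sym => //; case: d.
Qed.

Lemma es_flush x m bit a rest pr T c hb : a = KComma \/ a = KRPar ->
  value_ge_at x (Scan m (if a is KComma then Some (~~ bit) else None))
    rest true pr (T + c) 0 hb ->
  value_ge_at x (Scan m (Some bit)) (a :: rest) true pr T c hb.
Proof.
move=> Ha Hr; apply: (es_step _ _ _ _ Hr) => //.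
- by case: Ha => ->; case: (m).
- by case: Ha => ->; case: (m); case: (bit); exact: flushmxE.
- by case: Ha => ->; case: (m).
Qed.

(** The comma negates the selection, so exactly one number is added. The opening parenthesis resets
    the coin, so [rdy] is arbitrary on entry. *)
Lemma es_pair x m bit y rest rdy pr T hb :
  value_ge_at x (Scan m None) rest true pr
    (T + (bin_val (if bit then y.1 else y.2))%:R) 0 hb ->
  value_ge_at x (Scan m (Some bit)) (enc_pair y ++ rest) rdy pr T 0 hb.
Proof.
move=> Hr; rewrite /enc_pair /= -catA /= -catA /=.
case: bit Hr => Hr.
  apply: (es_step (q' := Scan m (Some true)) (pr' := pr) (T' := T) (c' := 0%N%:R)) => //.
  - by case: (m).
  - by case: (m); exact: mul1mx.
  apply: es_num_on; apply: es_flush; first by left.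
  apply: es_num_off => //; apply: es_flush; first by right.
  by rewrite addr0.
apply: es_skip_sym => //; apply: es_num_off => //; apply: es_flush; first by left.
rewrite addr0; apply: (@es_num_on x m y.2 _ pr T 0%N).
by apply: es_flush; first by right.
Qed.

Lemma es_skip x m u rest pr T c hb : all (predC (trigger m)) u ->
  value_ge_at x (Scan m None) rest true pr T c hb ->
  value_ge_at x (Scan m None) (u ++ rest) true pr T c hb.
Proof.
move=> au Hr; elim: u au => [//|a u IH] /= /andP[na /IH Hu].
apply: (es_step _ _ _ _ Hu) => //.
- by case: (m) na => //; case: (a).
- suff -> : accop delta (Scan m None) (Sym a) = 1%:M by rewrite mul1mx.
  by case: (m) na => //; case: (a).
- by case: (m) na => //; case: (a).
Qed.

Lemma es_coin_block x y blk rest s pr T c hb :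
  value_ge_at x (Scan false None) rest true (pr / 2)
     (T - c + (bin_val (blk_univ blk).1)%:R) 0 (rcons hb true) ->
  value_ge_at y (Scan false None) rest true (pr / 2)
     (T - c + (bin_val (blk_univ blk).2)%:R) 0 (rcons hb false) ->
  value_ge_at ((x + y) / 2) (Scan false s) (enc_block blk ++ rest) true pr T c hb.
Proof.
move=> Hx Hy pre Ew; rewrite enc_blockE cat_cons -catA in Ew.
set rst := enc_pair _ ++ _ in Ew.
have tp : tape w (size pre).+1 = Sym KForall by rewrite Ew tape_sym.
have np : newpos (size w) (size pre).+1 MRight = (size (rcons pre KForall)).+1.
  by rewrite Ew newpos_right.
have Ew' : w = rcons pre KForall ++ rst by rewrite cat_rcons.
(* Forgetting the form of the prefix folds both goals back into [value_ge_at]. *)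
apply: ev_coin; rewrite // np; move: Ew'; move: (rcons pre _);
  rewrite -/(value_ge_at _ _ _ _ _ _ _ _).
- apply: es_pair; apply: es_skip => //.
  exact: (no_trigger_pair false).
- apply: es_pair; apply: es_skip => //.
  exact: (no_trigger_pair false).
Qed.

(** The end-marker also applies [debitmx], which accounts for the successor in the exponent of
    [coin_pass]. *)
Lemma es_end_coin x s pr T c hb :
  value_ge x (Back true) (size w) true (pr / 2) (T - c) 0 hb ->
  value_ge_at x (Scan false s) [::] true pr T c hb.
Proof.
move=> Hx pre; rewrite cats0 => <-.
apply: ev_det; rewrite ?tape_end //.
- by case: (s) => [[]|]; exact: debitmxE.
- by [].
Qed.

(* One distinguished coin sequence [cx] is worth [v], every other one at least [u]. *)
Lemma coin_pass u v blks cx s pr T c hb : size cx = size blks ->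
  (forall cx', size cx' = size blks ->
     value_ge u (Back true) (size w) true (pr / 2 ^+ (size blks).+1)
        (T - c + (selsum (map blk_univ blks) cx')%:R) 0 (hb ++ cx')) ->
  value_ge v (Back true) (size w) true (pr / 2 ^+ (size blks).+1)
     (T - c + (selsum (map blk_univ blks) cx)%:R) 0 (hb ++ cx) ->
  value_ge_at (u + (v - u) / 2 ^+ size blks) (Scan false s) (flatten (map enc_block blks))
     true pr T c hb.
Proof.
elim: blks v cx s pr T c hb => [|blk blks IH] v cx s pr T c hb.
  move=> /size0nil -> _ Hv; apply: es_end_coin.
  by move: Hv; rewrite /= cats0 expr1 addr0 expr0 divr1 subrKC.
case: cx => [//|c0 cx] [scx] Hu Hv.
have p2 : pr / 2 / 2 ^+ (size blks).+1 = pr / 2 ^+ (size blks).+2.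
  by rewrite [in RHS]exprS; field; rewrite expf_neq0.
have Hgen v' cx' bit : size cx' = size blks ->
    value_ge v' (Back true) (size w) true (pr / 2 ^+ (size blks).+2)
     (T - c + (selsum (map blk_univ (blk :: blks)) (bit :: cx'))%:R) 0 (hb ++ bit :: cx') ->
    value_ge_at (u + (v' - u) / 2 ^+ size blks) (Scan false None)
      (flatten (map enc_block blks)) true
      (pr / 2) (T - c + (bin_val (if bit then (blk_univ blk).1 else (blk_univ blk).2))%:R)
      0 (rcons hb bit).
  move=> sc Hv'; have key cx2 : T - c + (selsum (map blk_univ (blk :: blks)) (bit :: cx2))%:R =
    T - c + (bin_val (if bit then (blk_univ blk).1 else (blk_univ blk).2))%:R - 0
      + (selsum (map blk_univ blks) cx2)%:R.
    by rewrite /selsum /= natrD subr0 addrA.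
  apply: (IH _ cx') => //.
    move=> cx2 s2; rewrite p2 -key cat_rcons; apply: Hu; by rewrite /= s2.
  by rewrite p2 -key cat_rcons.
(* By induction the branch that follows [cx] exceeds [u] by [(v - u) / 2 ^+ size blks], and the
   other branch is worth [u]; averaging halves the excess. *)
have E : u + (v - u) / 2 ^+ (size blks).+1 =
   ((u + (v - u) / 2 ^+ size blks) + (u + (u - u) / 2 ^+ size blks)) / 2.
  by rewrite exprS; field; rewrite expf_neq0.
rewrite [size (_ :: _)]/= E /=.
(* Off the distinguished sequence only [u] is claimed, so there an arbitrary sequence can be
   distinguished, with [v = u]. *)
have Hother bit := Hgen u (nseq (size blks) true) bit.
case: c0 Hv => Hv; last rewrite [X in value_ge_at (X / 2)]addrC.
  apply: es_coin_block; first exact: (Hgen _ _ true scx Hv).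
  by apply: (Hother false); rewrite ?size_nseq //; apply: Hu; rewrite /= size_nseq.
apply: es_coin_block; last exact: (Hgen _ _ false scx Hv).
by apply: (Hother true); rewrite ?size_nseq //; apply: Hu; rewrite /= size_nseq.
Qed.

(* Messages are indexed by the number of existential pairs still to come, so that
   admissibility is preserved when the list is shortened from the left. *)
Fixpoint okseq (ok : nat -> bool -> bool) (cy : seq bool) : bool :=
  if cy is c :: cy' then ok (size cy') c && okseq ok cy' else true.

Lemma count_exists_pair y : count (trigger true) (enc_pair y) = 0%N.
Proof.
have := no_trigger_pair true y; rewrite all_predC has_count -leqNgt leqn0.
by move/eqP.
Qed.

Lemma count_exists_blocks blks :
  count (trigger true) (flatten (map enc_block blks)) = size blks.
Proof.
elim: blks => [//|blk blks IH] /=.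
have cc a l : count (trigger true) (a :: l) = (trigger true a + count (trigger true) l)%N.
  by [].
by rewrite enc_blockE !(count_exists_pair, count_cat, cc) IH.
Qed.

(** The count of existential quantifiers to the right of the head tells which pair is being asked
    about. *)
Definition obeys (ok : nat -> bool -> bool) hb := forall h pre rest,
  w = pre ++ KExists :: rest -> endbits hb h ->
  ok (count (trigger true) rest)
     (P (rcons h (Scan true None, (size pre).+1, mko delta None None))).

Lemma ask_pass ok x blks pr T hb : obeys ok hb ->
  (forall cy, size cy = size blks -> okseq ok cy ->
     value_ge x (Scan true None) (size w).+1 true pr
        (T + (selsum (map blk_exis blks) cy)%:R) 0 hb) ->
  value_ge_at x (Scan true None) (flatten (map enc_block blks)) true pr T 0 hb.
Proof.
move=> okP; elim: blks T => [|blk blks IH] T Hx.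
  move=> pre; rewrite cats0 => <-.
  by have := Hx [::] erefl isT; rewrite addr0.
rewrite /= enc_blockE -cat_cons -catA; apply: es_skip.
  exact: (no_trigger_pair true).
move=> pre; rewrite cat_cons => Ew.
have tp : tape w (size pre).+1 = Sym KExists by rewrite Ew tape_sym.
have np : newpos (size w) (size pre).+1 MRight = (size (rcons pre KExists)).+1.
  by rewrite [in LHS]Ew newpos_right.
have Ew' : w = rcons pre KExists ++ enc_pair (blk_exis blk) ++ flatten (map enc_block blks).
  by rewrite cat_rcons [LHS]Ew /=.
apply: (ev_msg (ok := ok (size blks)) (pr' := pr) (T' := T) (c' := 0)); rewrite ?tp //.
- exact: mul1mx.
- move=> h hok; have := okP h _ _ Ew hok.
  by rewrite count_cat count_exists_pair count_exists_blocks.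
move=> g gok /=; rewrite -[minn _ _]/(newpos (size w) (size pre).+1 MRight) np.
move: (rcons pre _) Ew'; rewrite -/(value_ge_at _ _ _ _ _ _ _ _).
apply: es_pair; apply: IH => cy scy cyok.
have := Hx (g :: cy); rewrite /= scy cyok gok => /(_ erefl isT).
by rewrite /selsum /= natrD addrA.
Qed.

(** * A complete round *)

Lemma ev_back x m p rdy pr T c pr' T' c' hb : (p <= size w)%N ->
  accop delta (Back m) LEnd *m vec pr T c = vec pr' T' c' ->
  value_ge x (Scan m (if m then None else Some true)) 1 true pr' T' c' hb ->
  value_ge x (Back m) p rdy pr T c hb.
Proof.
move=> + HV Hx; elim: p rdy => [|p IH] rdy ltp.
  apply: (ev_det (q := Back m) (p := 0%N) _ _ _ HV) => // g.
  by rewrite /vtrans /= minnSS min0n.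
have tp : tape w p.+1 = Sym (nth K0 w p) by rewrite /= (nth_map K0).
apply: (ev_det (pr' := pr) (T' := T) (c' := c)) => //; rewrite ?tp.
- by case: (m); exact: mul1mx.
- by move=> g /=; apply: IH; rewrite ltnW.
Qed.

Definition round_ge x := value_ge x (Scan false (Some true)) 1 true delta 0 0 [::].

(** The left end-marker resets the accumulator whatever it held, and [round_ge] prescribes no
    earlier coin flips, so all rounds are alike. *)
Lemma start_back x p rdy pr T c hb : (p <= size w)%N -> round_ge x ->
  value_ge x (Back false) p rdy pr T c hb.
Proof.
move=> lep Hx; apply: ev_nil; apply: ev_back Hx => //.
by rewrite /= constmxE //; exact: affine_vec_vec.
Qed.

Definition endval (al T x : rat) : rat :=
  ((if b then al else 2 * `|T|) + (1 - al) * x) / (1 + 2 * `|T|).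

(** The recursion between rounds: a bound [x] for the next round, entering through [endval], yields
    a bound for the present one. Soundness distinguishes a losing [cx0]; completeness takes
    [u = v]. *)
Lemma round (ok : seq bool -> nat -> bool -> bool) s blks cx0 x u v :
  0 <= delta -> delta <= 1 ->
  w = enc_bin s ++ flatten (map enc_block blks) ->
  (forall cx, size cx = size blks -> obeys (ok cx) cx) ->
  let n := size blks in let al := delta / 2 ^+ n.+1 in
  let bal cx cy : rat := - (bin_val s)%:R + (selsum (map blk_univ blks) cx)%:R
     + (selsum (map blk_exis blks) cy)%:R in
  size cx0 = n ->
  (forall cx cy, size cx = n -> size cy = n -> okseq (ok cx) cy ->
     u <= endval al (bal cx cy) x) ->
  (forall cy, size cy = n -> okseq (ok cx0) cy -> v <= endval al (bal cx0 cy) x) ->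
  round_ge x -> round_ge (u + (v - u) / 2 ^+ n).
Proof.
move=> d0 d1 Ew okP n al bal scx0 Hu Hv Hx.
have al0 : 0 <= al by rewrite divr_ge0 ?exprn_ge0.
have al1 : al <= 1.
  by rewrite ler_pdivrMr ?exprn_gt0 // mul1r (le_trans d1) // exprn_ege1.
(* The asking pass after fixed coins is isolated, as it serves all [cx] with bound [u] and [cx0]
   with bound [v]. *)
suff Hcx cx z : size cx = n ->
    (forall cy, size cy = n -> okseq (ok cx) cy -> z <= endval al (bal cx cy) x) ->
    value_ge z (Back true) (size w) true al
       (0 - (bin_val s)%:R + (selsum (map blk_univ blks) cx)%:R)
       0 ([::] ++ cx).
  have /= H1 : value_ge_at (u + (v - u) / 2 ^+ n)
      (Scan false (Some true)) w true delta 0 0 [::].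
    rewrite [w in value_ge_at _ _ w]Ew; apply: (@es_num_on _ _ s _ _ _ 0%N).
    apply: (coin_pass (cx := cx0)) => // [cx scx|].
      by apply: (Hcx) => // cy; exact: Hu.
    by apply: Hcx.
  exact: (H1 [::]).
move=> scx Hz; rewrite sub0r /=.
apply: (@ev_back z true) => //; first exact: mul1mx.
suff H1 : value_ge_at z (Scan true None) w true al
    (- (bin_val s)%:R + (selsum (map blk_univ blks) cx)%:R) 0 cx.
  exact: (H1 [::]).
rewrite [w in value_ge_at _ _ w]Ew; apply: es_num_off => //.
apply: (ask_pass (okP _ scx)) => cy scy cyok.
apply: ev_weak (Hz _ scy cyok) _; apply: ev_check => //; first exact: tape_end.
exact: start_back.
Qed.
End Passes.

Arguments es_step {delta b w P x q a rest q' rdy pr T c pr' T' c' hb}.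

(** * The input format *)

Fixpoint frun (f : fstate) (u : seq kgsym) : option fstate :=
  if u is a :: u' then (if fstep f a is Some f' then frun f' u' else None) else Some f.

(** Starting from [FS], the final state [FQ false] forces at least one block, since [FS] is left
    only through a universal quantifier. *)
Definition fmt_ok (f : fstate) (u : seq kgsym) : bool :=
  if frun f u is Some (FQ false) then true else false.

Definition blk_ok (blk : seq bool * seq bool * seq bool * seq bool) : bool :=
  let: (a, b, e, f) := blk in [&& a != [::], b != [::], e != [::] & f != [::]].

Lemma fmt_num q c st u : fmt_ok (FNum q c st) u -> exists a u',
  [/\ st || (a != [::]), u = enc_bin a ++ (if c then KRPar else KComma) :: u'
    & fmt_ok (if c then FQ (~~ q) else FNum q true false) u'].
Proof.
elim: u st => [//|x u IH] st; case: x => //.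
- move=> /(IH true) [a [u' [_ -> ok]]].
  by exists (false :: a), u'; rewrite orbT.
- move=> /(IH true) [a [u' [_ -> ok]]].
  by exists (true :: a), u'; rewrite orbT.
- by case: c st {IH} => [] [] // ok; exists [::], u.
- by case: c st {IH} => [] [] // ok; exists [::], u.
Qed.

Lemma fmt_pair q u : fmt_ok (FPar q) u -> exists y u',
  [/\ y.1 != [::], y.2 != [::], u = enc_pair y ++ u' & fmt_ok (FQ (~~ q)) u'].
Proof.
case: u => [//|[]] // u /fmt_num [a [u1 [/= na -> /fmt_num [b [u2 [/= nb -> ok]]]]]].
by exists (a, b), u2; split=> //; rewrite /enc_pair /= -catA /= -catA.
Qed.

Lemma enc_blocks_cons blk blks : flatten (map enc_block (blk :: blks)) =
  enc_block blk ++ flatten (map enc_block blks).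
Proof. by []. Qed.

Lemma fmt_blocks u : fmt_ok (FQ false) u -> exists blks,
  all blk_ok blks /\ u = flatten (map enc_block blks).
Proof.
have [n] := ubnP (size u); elim: n u => // n IH [|[] u] //; first by exists [::].
rewrite ltnS => ltu /fmt_pair [[a b] [u1 [na nb E1 ok1]]].
case: u1 E1 ok1 => [//|[]] // u1 E1 /fmt_pair [[e f] [u2 [ne nf E2 ok2]]].
have [|blks [okb E3]] := IH u2 _ ok2.
  apply: leq_trans ltu; rewrite E1 E2.
  have sc (x : kgsym) l : size (x :: l) = (size l).+1 by [].
  rewrite sc ltnS size_cat sc size_cat addnS addnA.
  by apply: leqW; exact: leq_addl.
exists ((a, b, e, f) :: blks); split; first by rewrite /= okb na nb ne nf.
by rewrite enc_blocks_cons -E3 enc_blockE cat_cons -catA E1 E2.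
Qed.

Lemma fmt_target st u : fmt_ok (FS st) u -> exists s u',
  [/\ st || (s != [::]), u = enc_bin s ++ KForall :: u' & fmt_ok (FPar false) u'].
Proof.
elim: u st => [|x u IH] st; first by case: st.
case: x => // [||ok]; try by case: st.
- move=> /(IH true) [a [u' [_ -> ok]]].
  by exists (false :: a), u'; rewrite orbT.
- move=> /(IH true) [a [u' [_ -> ok]]].
  by exists (true :: a), u'; rewrite orbT.
- by case: st ok => // ok; exists [::], u.
Qed.

Lemma fmt_okP w : fmt_ok (FS false) w -> exists s blks,
  [/\ (0 < size blks)%N, s != [::], all blk_ok blks
    & w = enc_bin s ++ flatten (map enc_block blks)].
Proof.
move=> /fmt_target [s [u [ns -> ok]]].
(* The quantifier that ended [S] is put back, so that the rest is a sequence of blocks, nonempty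
   because the string is. *)
have [blks [okb E]] := @fmt_blocks (KForall :: u) ok.
by exists s, blks; rewrite -E; split=> //; case: blks E {okb}.
Qed.

(** * Encodings pass the format check *)

Lemma fmt_num_enc q c st a u : st || (a != [::]) ->
  fmt_ok (FNum q c st) (enc_bin a ++ (if c then KRPar else KComma) :: u) =
  fmt_ok (if c then FQ (~~ q) else FNum q true false) u.
Proof.
elim: a st => [|d a IH] st /=; first by rewrite orbF; case: st c => [] [].
by move=> _; rewrite -(IH true) //; case: d.
Qed.

Lemma fmt_pair_enc q y u : y.1 != [::] -> y.2 != [::] ->
  fmt_ok (FPar q) (enc_pair y ++ u) = fmt_ok (FQ (~~ q)) u.
Proof.
move=> n1 n2; rewrite /enc_pair /= -catA /= -catA /=.
rewrite -[LHS]/(fmt_ok (FNum q false false) _).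
by rewrite (@fmt_num_enc q false) // (@fmt_num_enc q true).
Qed.

Lemma fmt_blocks_enc blks : all blk_ok blks ->
  fmt_ok (FQ false) (flatten (map enc_block blks)).
Proof.
elim: blks => [//|[[[a b] e] f] blks IH] /andP[/and4P[na nb ne nf] /IH ok].
rewrite enc_blocks_cons enc_blockE cat_cons -catA cat_cons.
have s1 u : fmt_ok (FQ false) (KForall :: u) = fmt_ok (FPar false) u by [].
have s2 u : fmt_ok (FQ true) (KExists :: u) = fmt_ok (FPar true) u by [].
by rewrite s1 fmt_pair_enc // s2 fmt_pair_enc.
Qed.

Lemma fmt_ok_enc s blks : (0 < size blks)%N -> s != [::] -> all blk_ok blks ->
  fmt_ok (FS false) (enc_bin s ++ flatten (map enc_block blks)).
Proof.
move=> nb ns okb.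
have H st : st || (s != [::]) ->
    fmt_ok (FS st) (enc_bin s ++ flatten (map enc_block blks)).
  elim: s {ns} st => [|d s IH] st /=.
    rewrite orbF => ->; case: blks nb okb => // blk blks _ /fmt_blocks_enc.
    by rewrite enc_blocks_cons enc_blockE.
  by move=> _; have := IH true isT; case: d.
exact: H.
Qed.

Section Format.
Variables (delta : rat) (b : bool) (w : seq kgsym) (P : prover (kg_verifier delta)).

(** A format error leads to [Rej], which is worth 1 when rejection is measured and 0 when acceptance
    is; hence the second hypothesis. *)
Lemma fmt_pass (x : rat) f u rdy hb :
  (fmt_ok f u -> round_ge b w P x) -> (~~ fmt_ok f u -> ~~ b /\ x <= 1) ->
  value_ge_at b w P x (Fmt f) u rdy delta 0 0 hb.
Proof.
move=> H1 H2.
have Hrej p pr T c : ~~ b /\ x <= 1 -> value_ge b w P x Rej p true pr T c hb.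
  by case=> nb x1; exists 0%N => V h _ _; rewrite haltp_Rej nb.
elim: u f rdy H1 H2 => [|a u IH] f rdy H1 H2.
  move=> pre; rewrite cats0 => <-.
  apply: (ev_det (pr' := delta) (T' := 0) (c' := 0)); rewrite ?tape_end //.
    exact: mul1mx.
  move=> g; case: f H1 H2 => [s|[]|q|q c s] H1 H2; try by apply: Hrej; apply: H2.
  by apply: start_back => //; exact: H1.
case E: (fstep f a) => [f'|].
  apply: (es_step (q' := Fmt f') (pr' := delta) (T' := 0) (c' := 0)) => //.
  - exact: mul1mx.
  - by move=> g; rewrite /vtrans E.
  - by apply: IH => ok; [apply: H1|apply: H2]; rewrite /fmt_ok /= E.
move=> pre Ew; have tp : tape w (size pre).+1 = Sym a by rewrite Ew tape_sym.
apply: (ev_det (pr' := delta) (T' := 0) (c' := 0)); rewrite ?tp //.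
  exact: mul1mx.
move=> g qm; have -> : qm = (Rej, MStay) by rewrite /qm /vtrans E.
by apply: Hrej; apply: H2; rewrite /fmt_ok /= E.
Qed.

Lemma run_from_start (x : rat) :
  (fmt_ok (FS false) w -> round_ge b w P x) ->
  (~~ fmt_ok (FS false) w -> ~~ b /\ x <= 1) ->
  exists t, x <= haltp b w P t (q0 (kg_verifier delta)) 0 (init (kg_verifier delta)) [::].
Proof.
move=> H1 H2.
have Hs := @fmt_pass x (FS false) w true [::] H1 H2 [::] erefl.
suff [t Ht] : value_ge b w P x (Fmt (FS false)) 0 true delta 0 0 [::].
  exists t; apply: Ht; last by exists [::].
  by split=> //; exact: affine_coin.
apply: (ev_det (pr' := delta) (T' := 0) (c' := 0)) => //; first exact: mul1mx.
by move=> g; rewrite /vtrans /= minnSS min0n.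
Qed.
End Format.

(** * Completeness and soundness *)

(* As long as an iterate is below [r - d], the next one is larger by at least
   [(1 - c) * d]; by the Archimedean property this cannot go on forever. *)
Lemma affine_iterates_approach (F : rat -> Prop) (s c r : rat) :
  0 <= s -> 0 <= c -> s + c <= 1 -> c < 1 -> r * (1 - c) <= s ->
  F 0 -> (forall x, 0 <= x -> x <= 1 -> F x -> F (s + c * x)) ->
  forall d, 0 < d -> exists2 x, r - d <= x & F x.
Proof.
move=> s0 c0 sc c1 rs F0 FS d d0.
have Hk (k : nat) : exists x,
    [/\ 0 <= x, x <= 1, F x & r - d <= x \/ k%:R * ((1 - c) * d) <= x].
  elim: k => [|k [x [x0 x1 Fx [rx|kx]]]].
  - by exists 0; split=> //; right; rewrite mul0r.
  - by exists x; split=> //; left.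
  - have [rx|rx] := lerP (r - d) x; first by exists x; split=> //; left.
    exists (s + c * x); split; [by nra|by nra|exact: FS|right].
    (* The increment is [s - (1 - c) * x >= (1 - c) * (r - x)], and [r - x > d] here. *)
    rewrite -natr1; nra.
have ed : 0 < (1 - c) * d by rewrite mulr_gt0 ?subr_gt0.
have := archi_boundP (ltW (_ : 0 < ((1 - c) * d)^-1)); rewrite invr_gt0 => /(_ ed).
set k := Num.bound _ => hk.
have [x [x0 x1 Fx [rx|kx]]] := Hk k; exists x => //.
have : 1 < k%:R * ((1 - c) * d) by rewrite -ltr_pdivrMr // div1r.
by move=> h; have := lt_le_trans h (le_trans kx x1); rewrite ltxx.
Qed.

(** * The game in terms of [selsum], and soundness *)

Lemma selsum_bigE blks (cx cy : seq bool) :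
  size cx = size blks -> size cy = size blks ->
  (\sum_(i < size blks)
     let: (a, b, e, f) := nth ([::], [::], [::], [::]) blks i in
     (bin_val (if nth false cx i then a else b) +
      bin_val (if nth false cy i then e else f)))%N =
  (selsum (map blk_univ blks) cx + selsum (map blk_exis blks) cy)%N.
Proof.
elim: blks cx cy => [|[[[a b] e] f] blks IH] [|c cx] [|d cy] //; first by rewrite big_ord0.
move=> [sx] [sy]; rewrite big_ord_recl /= (IH _ _ sx sy) /selsum /=.
by rewrite addnACA.
Qed.

(** With [r] pairs still to come, the entry due is number [r] from the end of [y], so the constraint
    leaves a single sequence. *)
Lemma okseq_nth_rev (y cy : seq bool) : size cy = size y ->
  okseq (fun r g => g == nth false (rev y) r) cy -> cy = y.
Proof.
have ext ok ok' z : (forall r g, (r < size z)%N -> ok r g = ok' r g) ->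
    okseq ok z = okseq ok' z.
  elim: z => //= c z IH H; rewrite H // IH // => r g lt.
  by apply: H; rewrite ltnW.
elim: cy y => [|c cy IH] [|d y] //= [sz] /andP[/eqP -> ok].
rewrite rev_cons nth_rcons size_rev sz ltnn eqxx; congr (_ :: _).
apply: IH => //; move: ok; rewrite (ext _ (fun r g => g == nth false (rev y) r)) //.
by move=> r g lt; rewrite rev_cons nth_rcons size_rev -sz lt.
Qed.

Definition solves s blks (cx cy : seq bool) : bool :=
  bin_val s == (selsum (map blk_univ blks) cx + selsum (map blk_exis blks) cy)%N.

Lemma in_LKG_enc s blks : (0 < size blks)%N -> s != [::] -> all blk_ok blks ->
  (forall cx, size cx = size blks -> exists2 cy, size cy = size blks & solves s blks cx cy) ->
  in_LKG (enc_bin s ++ flatten (map enc_block blks)).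
Proof.
move=> nb ns okb H; exists s, blks; split=> // cx scx.
have [cy scy /eqP E] := H cx scx; exists cy; split=> //.
by rewrite selsum_bigE.
Qed.

(** Distinct integers differ by at least 1; this is what makes the rejection probability of a lost
    play at least 2/3. *)
Lemma norm_balance_ge1 (s x y : nat) : s != (x + y)%N ->
  1 <= `|- s%:R + x%:R + y%:R : rat|.
Proof.
rewrite ler_normr neq_ltn => /orP[]; rewrite -(ler_nat rat) -natr1 natrD => h.
  by apply/orP; left; lra.
by apply/orP; right; lra.
Qed.

(** A round turns a rejection bound [x] into [rho + (1 - rho) * (1 - al) * x]. The fixed point is at
    least [rho / (rho + al)], and [al = 3/4 * eps * rho] makes this at least [1 - eps]. *)
Lemma kg_verifier_sound (eps : rat) w (P : prover (kg_verifier eps)) : 0 < eps -> eps < 1 ->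
  ~ in_LKG w -> prob_ge (rej_within w P) (1 - eps).
Proof.
move=> eps0 eps1 nL d d0; case ok: (fmt_ok (FS false) w); last first.
  have [||t Ht] := @run_from_start eps false w P 1; rewrite ?ok //.
  by exists t; apply: le_trans _ Ht; lra.
have [s [blks [nb ns okb Ew]]] := fmt_okP ok.
pose n := size blks.
(* Coin and answer sequences are finite tuples, so the negation passes through the quantifiers by a
   boolean decision. *)
have [cx scx bad] : exists2 cx, size cx = n &
    forall cy, size cy = n -> ~~ solves s blks cx cy.
  have [|/negP nall] :=
    boolP [forall cx : n.-tuple bool, exists cy : n.-tuple bool, solves s blks cx cy].
    move=> /forallP all; case: nL; rewrite Ew; apply: in_LKG_enc => // cx scx.
    have /existsP [cy Hcy] := all (tcast scx (in_tuple cx)).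
    by exists cy; rewrite ?size_tuple //; move: Hcy; rewrite val_tcast.
  have /forallPn [cx /existsPn Hcx] := introN idP nall.
  exists cx; rewrite ?size_tuple // => cy scy.
  by have := Hcx (tcast scy (in_tuple cy)); rewrite val_tcast.
pose al := eps / 2 ^+ n.+1; pose rho : rat := 2 / 3 / 2 ^+ n.
have p2 : 0 < (2 ^+ n : rat) by rewrite exprn_gt0.
have p21 : 1 <= (2 ^+ n : rat) by rewrite exprn_ege1.
pose i : rat := (2 ^+ n)^-1.
have i0 : 0 < i by rewrite invr_gt0.
have i1 : i <= 1 by rewrite invf_le1.
have alE : al = eps / 2 * i by rewrite /al /i exprS; field; rewrite gt_eqF.
have rhoE : rho = 2 / 3 * i by [].
have step x : 0 <= x -> x <= 1 -> round_ge false w P x ->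
    round_ge false w P (rho + (1 - rho) * (1 - al) * x).
  move=> x0 x1 Hx; pose u := (1 - al) * x.
  have al0 : 0 <= al by rewrite alE; nra.
  have al1 : al <= 1 by rewrite alE; nra.
  have u1 : u <= 1 by rewrite /u; nra.
  have -> : rho + (1 - rho) * (1 - al) * x = u + ((2 + u) / 3 - u) / 2 ^+ n.
    (* The bound [(2 * t + u) / (1 + 2 * t)] grows with [t = |T|] because [u <= 1]: it is [u] at
       [t = 0] and [(2 + u) / 3] at [t = 1]. *)
    by rewrite -/i rhoE /u; field.
  apply: (@round eps false w P (fun _ _ _ => true) s blks cx x) => //; [lra|lra| |].
  - move=> cx' cy _ _ _; rewrite /endval -/al -/u.
    set z := (X in `|X|); move: `|z| (normr_ge0 z) => t t0.
    rewrite ler_pdivlMr; last by lra.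
    by nra.
  - move=> cy scy _; rewrite /endval -/al -/u.
    have := norm_balance_ge1 (bad cy scy).
    set z := (X in `|X|); move: `|z| => t t1.
    rewrite ler_pdivlMr; last by lra.
    by nra.
have rho0 : 0 < rho by rewrite rhoE; lra.
have rho1 : rho <= 2 / 3 by rewrite rhoE; lra.
have alrho : al = 3 / 4 * eps * rho by rewrite alE rhoE; field.
have al0 : 0 < al by rewrite alrho; nra.
have al1 : al <= 1 by rewrite alrho; nra.
have [|||||x rx Hx] := @affine_iterates_approach (round_ge false w P) rho
  ((1 - rho) * (1 - al)) (1 - eps) _ _ _ _ _ (ev0 _ _ _ _ _ _ _ _ _ _) step d d0.
- exact: ltW.
- by apply: mulr_ge0; lra.
- by have : 0 <= (1 - rho) * al by [apply: mulr_ge0; lra]; lra.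
- by have : 0 <= rho * (1 - al) by [apply: mulr_ge0; lra]; lra.
- have le1 : (1 - eps) * (1 - (1 - rho) * (1 - al)) <= (1 - eps) * (rho + al).
    have : 0 <= rho * al by rewrite mulr_ge0 ?ltW.
    by move=> h; rewrite ler_wpM2l //; lra.
  apply: le_trans le1 _; rewrite alrho.
  have -> : (1 - eps) * (rho + 3 / 4 * eps * rho) =
     rho - rho * eps * (1 / 4 + 3 / 4 * eps) by field.
  by rewrite gerBl; apply: mulr_ge0; [apply: mulr_ge0; lra|lra].
have [|t Ht] := @run_from_start eps false w P x (fun _ => Hx); rewrite ?ok //.
by exists t; apply: le_trans rx _.
Qed.

(** * The honest prover and completeness *)

Definition answer s blks (cx : seq bool) : seq bool :=
  odflt [::] (omap val [pick cy : (size blks).-tuple bool | solves s blks cx cy]).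

(* The last [n] coin flips of the history are those of the current round. *)
Definition honest eps w s blks : prover (kg_verifier eps) := fun h =>
  if rev h is (_, p, _) :: _ then
    let bits := coinbits h in
    nth false (rev (answer s blks (drop (size bits - size blks) bits)))
        (count (trigger true) (drop p w))
  else false.

Lemma honest_obeys eps w s blks cx : size cx = size blks ->
  obeys w (@honest eps w s blks) (fun r g => g == nth false (rev (answer s blks cx)) r) cx.
Proof.
move=> scx h pre rest Ew [bs Eb]; rewrite /honest rev_rcons.
(* The query itself flips no coin, so the last [size blks] flips are exactly [cx]. *)
rewrite coinbits_rcons cats0 Eb size_cat scx addnK drop_size_cat //.
(* Head positions count from the left end-marker, so dropping as many symbols as the position leaves
   what is right of the head. *)
have -> : drop (size pre).+1 w = rest by rewrite Ew -cat_rcons drop_size_cat ?size_rcons.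
by [].
Qed.

(** The honest answers give balance 0, so [endval] is [al + (1 - al) * x], a recursion with fixed
    point 1. *)
Lemma kg_verifier_complete (eps : rat) w : 0 < eps -> eps < 1 -> in_LKG w ->
  exists P : prover (kg_verifier eps), prob_ge (acc_within w P) 1.
Proof.
move=> eps0 eps1 [s [blks [nb ns okb Ew sol]]].
exists (@honest eps w s blks) => d d0; set P := @honest eps w s blks.
have fok : fmt_ok (FS false) w by rewrite Ew fmt_ok_enc.
have answerP cx : size cx = size blks ->
    size (answer s blks cx) = size blks /\ solves s blks cx (answer s blks cx).
  move=> scx; rewrite /answer; case: pickP => [cy Hcy|none] /=.
    by rewrite size_tuple.
  have [cy [scy E]] := sol cx scx.
  have := none (tcast scy (in_tuple cy)); rewrite val_tcast /= => /eqP[].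
  by rewrite E selsum_bigE.
pose n := size blks; pose al := eps / 2 ^+ n.+1.
have al0 : 0 < al by rewrite divr_gt0 ?exprn_gt0.
have al1 : al <= 1.
  by rewrite ler_pdivrMr ?exprn_gt0 // mul1r (le_trans (ltW eps1)) // exprn_ege1.
have step x : 0 <= x -> x <= 1 -> round_ge true w P x -> round_ge true w P (al + (1 - al) * x).
  move=> x0 x1 Hx; set u := al + _.
  (* All coin sequences are worth the same, so the distinguished one is arbitrary. *)
  have -> : u = u + (u - u) / 2 ^+ n by rewrite subrr mul0r addr0.
  have leaf cx cy : size cx = n -> size cy = n ->
      okseq (fun r g => g == nth false (rev (answer s blks cx)) r) cy ->
      u <= endval true al (- (bin_val s)%:R + (selsum (map blk_univ blks) cx)%:R
              + (selsum (map blk_exis blks) cy)%:R) x.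
    move=> scx scy cyok; have [sa /eqP ->] := answerP cx scx.
    rewrite (okseq_nth_rev _ cyok) ?sa // natrD -addrA addNr /endval normr0.
    by rewrite mulr0 addr0 divr1.
  apply: (@round eps true w P (fun cx r g => g == nth false (rev (answer s blks cx)) r)
    s blks (nseq n true) x) => //; rewrite ?size_nseq ?ltW //.
  - by move=> cx scx; exact: honest_obeys.
  - by move=> cy scy; apply: leaf; rewrite ?size_nseq.
have [|||||x rx Hx] := @affine_iterates_approach (round_ge true w P) al
  (1 - al) 1 _ _ _ _ _ (ev0 _ _ _ _ _ _ _ _ _ _) step d d0; try lra.
have [|t Ht] := @run_from_start eps true w P x (fun _ => Hx); rewrite ?fok //.
by exists t; apply: le_trans rx _.
Qed.

Theorem theorem7 (eps : rat) : 0 < eps -> eps < 1 / 2 ->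
  exists A : ADfA kgsym,
    verifies_with_error A in_LKG eps /\ perfect_completeness A in_LKG.
Proof.
move=> eps0 eps_half; have eps1 : eps < 1 by lra.
(* The error bound itself serves as the initial acceptance weight. *)
exists (kg_verifier eps); split; last by move=> w; exact: kg_verifier_complete.
split; first exact: kg_verifier_wf.
move=> w; split=> [Lw|nL P]; last exact: kg_verifier_sound.
have [P HP] := kg_verifier_complete eps0 eps1 Lw; exists P => d d0.
by have [t Ht] := HP d d0; exists t; apply: le_trans _ Ht; lra.
Qed.
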